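(* Let $\mathbb{K}$ be a commutative field, $n\ge 1$, and $A \in M_{n}(\mathbb{K})$. Then $A$ is $X$-formable if and only if its minimal polynomial $\pi_A$ over $\mathbb{K}$ can be written as \[\pi_{A}(X)=\prod_{i=1}^{r} P_{i}(X) \prod_{i=1}^{q} (X-\lambda_{i})^{n_{i}},\] with $r, q \geq 0$, the $P_{i}\in\mathbb{K}[X]$ irreducible (over $\mathbb{K}$) monic polynomials of degree $2$, $\lambda_{i} \in \mathbb{K}$, $1 \leq n_{i} \leq 2$, and $P_{i} \neq P_{j}$ and $\lambda_{i} \neq \lambda_{j}$ for $i \neq j$.
   Context: $M_n(\mathbb{K})$ is the set of $n\times n$ matrices over $\mathbb{K}$. An $X$-form matrix is a square matrix for which only the diagonal and the anti-diagonal elements can be different from zero (i.e. the $(i,j)$ entry is zero unless $i=j$ or $i+j=n+1$). A matrix in $M_n(\mathbb{K})$ is $X$-formable if it is similar over $\mathbb{K}$ to an $X$-form matrix. The minimal polynomial $\pi_A$ is taken monic. Empty products equal $1$. *)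

(* Defs.v *)
From mathcomp Require Import all_boot all_order all_algebra.

Set Implicit Arguments.
Unset Strict Implicit.
Unset Printing Implicit Defensive.

Import GRing.Theory.
Local Open Scope ring_scope.

(* Indices in 'I_n start at 0, so position i : 'I_n is the (i.+1)-th one: the
   anti-diagonal condition "i + j = n + 1" reads i.+1 + j.+1 = n.+1. *)
Definition is_Xform_mx (K : fieldType) (n : nat) (A : 'M[K]_n) : bool :=
  [forall i : 'I_n, forall j : 'I_n,
     (i != j) && (i.+1 + j.+1 != n.+1)%N ==> (A i j == 0)].

(* Same pattern as mxpoly's [diagonalizable]: some invertible P over K conjugates
   A into an X-form matrix. *)
Definition Xformable (K : fieldType) (n : nat) (A : 'M[K]_n) : Prop :=
  A ~_{in unitmx} {in @is_Xform_mx K n}.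

(* Main.v *)
(* If A is in X-form, each basis vector is annihilated by a monic quadratic
   polynomial in A (the characteristic polynomial of its 2 x 2 block), so the
   minimal polynomial divides the least common multiple of these quadratics,
   which divides a product of distinct irreducible quadratics and of squares of
   distinct linear factors.

   Conversely, take a maximal free family of pairs (u, u A) where u is killed by
   a quadratic which is irreducible or of the form (X - x)^2, and let W be its
   span. On W the kernel of A - x is contained in the image of A - x, so every
   vector killed by such a quadratic lies in W plus an eigenspace; adding a
   maximal free family of eigenvectors yields a subspace containing all these
   vectors, hence, by Bezout, everything. Nesting the pairs around
   the eigenvectors (paired arbitrarily) gives a basis in which A is in X-form. *)

Require Import Defs.
From Stdlib Require Import Classical.
From mathcomp Require Import all_boot all_order all_algebra.
From mathcomp Require Import ring.

Set Implicit Arguments.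
Unset Strict Implicit.
Unset Printing Implicit Defensive.

Import GRing.Theory.
Local Open Scope ring_scope.

(** * Divisors of products of powers of distinct irreducible polynomials *)

Lemma dvdp_irr_expX (K : fieldType) (F R p : {poly K}) (m : nat) :
  irreducible_poly F -> p %| F ^+ m * R ->
  exists (k : nat) (p' : {poly K}), [/\ (k <= m)%N, p = F ^+ k * p' & p' %| R].
Proof.
move=> irrF; elim: m p => [|m IHm] p.
  by rewrite mul1r => pR; exists 0, p; split; rewrite ?mul1r.
have [/dvdpP [q ->]|nFp] := boolP (F %| p).
  rewrite exprS -mulrA mulrC dvdp_mul2l ?irredp_neq0 // => /IHm [k [p' [km -> p'R]]].
  by exists k.+1, p'; split=> //; rewrite exprS mulrA.
rewrite exprS -mulrA Gauss_dvdpr; last by rewrite coprimep_sym irreducible_poly_coprime.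
by move=> /IHm [k [p' [km -> p'R]]]; exists k, p'; split=> //; rewrite leqW.
Qed.

Lemma dvdp_prod_irr_expX (K : fieldType) (m : {poly K} -> nat)
    (s : seq {poly K}) (p : {poly K}) :
  uniq s -> (forall F, F \in s -> irreducible_poly F /\ F \is monic) ->
  p \is monic -> p %| \prod_(F <- s) F ^+ m F ->
  exists2 e : {poly K} -> nat,
    forall F, (e F <= m F)%N & p = \prod_(F <- s) F ^+ e F.
Proof.
elim: s p => [|F s IHs] p /=.
  rewrite !big_nil dvdp1 => _ _ p_mon /size_poly1P[c _ def_p]; exists (fun=> 0%N) => //.
  by rewrite big_nil def_p; move/monicP: p_mon; rewrite def_p lead_coefC => ->.
case/andP=> Fs us irr_s p_mon; rewrite !big_cons.
have [irrF F_mon] := irr_s F (mem_head _ _).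
case/(dvdp_irr_expX irrF) => k [p' [km def_p p's]].
have [||e em def_p'] := IHs p' us _ _ p's.
- by move=> G Gs; apply: irr_s; rewrite inE Gs orbT.
- by rewrite def_p monicMl ?monic_exp in p_mon.
exists (fun G => if G == F then k else e G) => [G|].
  by case: eqP => [->|].
rewrite big_cons eqxx def_p def_p'; congr (_ * _).
by apply: eq_big_seq => G Gs; case: eqP Fs => // <-; rewrite Gs.
Qed.

(** The largest multiplicity that an irreducible factor of degree 2, respectively 1, can have in a
    quadratic polynomial; sizes are degrees plus one. *)
Definition irr_bound (K : fieldType) (F : {poly K}) : nat :=
  if size F == 3%N then 1 else 2.

(** Stands in for the least common multiple, of which it only needs to be a multiple. Thanks to
    [undup], factors can be added to [s] without checking whether they already occur. *)
Definition lcm_bound (K : fieldType) (s : seq {poly K}) : {poly K} :=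
  \prod_(F <- undup s) F ^+ irr_bound F.

Definition monic_irr23 (K : fieldType) (F : {poly K}) : Prop :=
  [/\ irreducible_poly F, F \is monic & size F = 2%N \/ size F = 3%N].

Lemma lcm_bound_cons (K : fieldType) (F : {poly K}) s :
  lcm_bound s %| lcm_bound (F :: s) /\ F ^+ irr_bound F %| lcm_bound (F :: s).
Proof.
rewrite /lcm_bound /=; case: ifP => Fs; last by rewrite big_cons dvdp_mulIl dvdp_mulIr.
by rewrite dvdpp (big_rem F) ?mem_undup //= dvdp_mulIl.
Qed.

Lemma monic_size2 (K : fieldType) (p : {poly K}) :
  p \is monic -> size p = 2%N -> p = 'X - (- p`_0)%:P.
Proof.
move=> /monicP; rewrite lead_coefE => + sz_p; rewrite sz_p /= => p1.
apply/polyP => -[|[|i]]; rewrite coefB coefX coefC /= ?sub0r ?opprK ?subr0 ?p1 //.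
by rewrite oppr0 nth_default ?sz_p.
Qed.

Lemma monic_quadratic_split (K : fieldType) (q : {poly K}) :
  q \is monic -> size q = 3%N ->
  irreducible_poly q \/ exists a b, q = ('X - a%:P) * ('X - b%:P).
Proof.
(* Having a root is not decidable over an arbitrary field, hence the classical case split. *)
move=> q_mon sz_q; case: (classic (exists a, root q a)) => [[a]|no_root]; last first.
  left; apply: cubic_irreducible; rewrite ?sz_q // => x; apply/negP => qx.
  by apply: no_root; exists x.
case/factor_theorem=> r def_q; right.
have r_mon : r \is monic by move: q_mon; rewrite def_q mulrC monicMl ?monicXsubC.
have sz_r : size r = 2%N.
  by move: sz_q; rewrite def_q size_Mmonic ?monicXsubC ?monic_neq0 // size_XsubC addn2 => -[].
exists a, (- r`_0); rewrite def_q mulrC; congr (_ * _).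
exact: monic_size2.
Qed.

(** An irreducible quadratic is added to the list as it stands; a split one contributes its two
    linear factors. *)
Lemma quadratics_lcm_bound (K : fieldType) (qs : seq {poly K}) :
  (forall q, q \in qs -> q \is monic /\ size q = 3%N) ->
  exists2 s, forall F, F \in s -> monic_irr23 F
    & forall q, q \in qs -> q %| lcm_bound s.
Proof.
elim: qs => [|q qs IHqs] hqs; first by exists [::].
have [q' q'qs|s irr_s dvd_s] := IHqs; first by apply: hqs; rewrite inE q'qs orbT.
have [q_mon sz_q] := hqs q (mem_head _ _).
have [irr_q|[a [b def_q]]] := monic_quadratic_split q_mon sz_q.
  have [sub_s dvd_q] := lcm_bound_cons q s.
  exists (q :: s) => [F|q']; rewrite inE => /predU1P[->|].
  - by split=> //; right.
  - exact: irr_s.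
  - by rewrite /irr_bound sz_q /= in dvd_q.
  - by move/dvd_s/dvdp_trans; apply.
have irrX (x : K) : monic_irr23 ('X - x%:P).
  by split; [apply: irredp_XsubC | rewrite monicXsubC | left; rewrite size_XsubC].
have [sub_b dvd_b] := lcm_bound_cons ('X - b%:P) s.
have [sub_a dvd_a] := lcm_bound_cons ('X - a%:P) (('X - b%:P) :: s).
exists [:: 'X - a%:P, 'X - b%:P & s] => [F|q'].
  by rewrite !inE => /or3P[/eqP->|/eqP->|/irr_s].
rewrite inE => /predU1P[->|]; last first.
  by move/dvd_s/dvdp_trans; apply; apply: dvdp_trans sub_b sub_a.
rewrite /irr_bound !size_XsubC /= in dvd_a dvd_b; rewrite def_q.
(* A double root uses up the exponent 2 granted to linear factors. Distinct roots give coprime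
   factors, so each one may be bounded separately. *)
have [eq_ab|neq_ab] := eqVneq a b.
  by rewrite {1}eq_ab -expr2 (dvdp_trans dvd_b).
rewrite Gauss_dvdp; last by rewrite coprimep_XsubC root_XsubC eq_sym.
apply/andP; split; last apply: (dvdp_trans _ sub_a).
  by apply: dvdp_trans dvd_a; rewrite expr2 dvdp_mulIl.
by apply: dvdp_trans dvd_b; rewrite expr2 dvdp_mulIl.
Qed.

Definition minpoly_form (K : fieldType) (p : {poly K}) : Prop :=
  exists (r q : nat) (P : 'I_r -> {poly K}) (lambda : 'I_q -> K)
         (e : 'I_q -> nat),
    [/\ forall i : 'I_r,
          [/\ irreducible_poly (P i), P i \is monic & size (P i) = 3%N],
        injective P,
        injective lambda,
        forall i : 'I_q, (1 <= e i <= 2)%N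
      & p = (\prod_(i < r) P i) * (\prod_(i < q) ('X - (lambda i)%:P) ^+ e i)].

Lemma dvdp_lcm_bound_form (K : fieldType) (s : seq {poly K}) (p : {poly K}) :
  (forall F, F \in s -> monic_irr23 F) -> p \is monic -> p %| lcm_bound s ->
  minpoly_form p.
Proof.
move=> irr_s p_mon p_dvd.
have [|e e_le def_p] := dvdp_prod_irr_expX (undup_uniq s) _ p_mon p_dvd.
  by move=> F; rewrite mem_undup => /irr_s [].
(* Listed factors of exponent 0 in [p] are dropped: they contribute 1 to the product, and the target
   form requires positive exponents. *)
pose ps := [seq F : {poly K} <- undup s | (size F == 3) && (e F == 1)%N].
pose ls := [seq F : {poly K} <- undup s | (size F == 2) && (0 < e F)%N].
pose root_of (F : {poly K}) := - F`_0.
have lsE F : F \in ls -> F = 'X - (root_of F)%:P.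
  rewrite mem_filter mem_undup => /andP[/andP[/eqP sz_F _] /irr_s[_ F_mon _]].
  exact: monic_size2.
pose rs := [seq root_of F | F <- ls].
have uniq_ps : uniq ps by rewrite filter_uniq ?undup_uniq.
have uniq_rs : uniq rs.
  rewrite map_inj_in_uniq ?filter_uniq ?undup_uniq // => F G /lsE {2}-> /lsE {2}->.
  by move=> ->.
exists (size ps), (size rs), (tnth (in_tuple ps)), (tnth (in_tuple rs)).
exists (fun i => e ('X - (tnth (in_tuple rs) i)%:P)); split.
- move=> i; have := mem_tnth i (in_tuple ps).
  rewrite mem_filter mem_undup => /andP[/andP[/eqP sz_F _] /irr_s[irrF F_mon _]].
  by split.
- exact/tuple_uniqP.
- exact/tuple_uniqP.
- move=> i; have /mapP[F Fls ->] := mem_tnth i (in_tuple rs).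
  rewrite -lsE //; move: Fls; rewrite mem_filter => /andP[/andP[/eqP sz_F ->] _].
  by have := e_le F; rewrite /irr_bound sz_F.
(* The products over ordinals become products over sublists of [undup s], to be compared with
   [def_p] degree by degree. *)
rewrite -(big_tnth _ _ rs xpredT (fun x => ('X - x%:P) ^+ e ('X - x%:P))).
rewrite -(big_tnth _ _ ps xpredT id) big_map /=.
under [X in _ * X]eq_big_seq => F /lsE <- do over.
rewrite !big_filter def_p (bigID (fun F : {poly K} => size F == 3)) /=.
congr (_ * _).
  rewrite (bigID (fun F => e F == 1)%N) /= [X in _ * X]big1 ?mulr1; last first.
    move=> F /andP[/eqP sz_F]; have := e_le F; rewrite /irr_bound sz_F /=.
    by case: (e F) => [|[|?]].
  by apply: eq_bigr => F /andP[_ /eqP ->].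
rewrite big_seq_cond (bigID (fun F => 0 < e F)%N) /= [X in _ * X]big1 ?mulr1; last first.
  by move=> F /andP[_]; rewrite -eqn0Ngt => /eqP ->.
rewrite [RHS]big_seq_cond; apply: eq_bigl => F; rewrite mem_undup andbA.
case Fs: (F \in s) => //=; congr (_ && _).
by have [_ _ [->|->]] := irr_s F Fs.
Qed.

(** * From an X-form to the factorization of the minimal polynomial *)

Lemma Xform_annihilated (K : fieldType) (n : nat) (B : 'M[K]_n.+1) (i : 'I_n.+1) :
  is_Xform_mx B ->
  exists q : {poly K}, [/\ q \is monic, size q = 3%N &
    delta_mx 0 i *m horner_mx B q = 0 :> 'rV_n.+1].
Proof.
move=> /forallP XB.
have XB0 j k : j != k -> k != rev_ord j -> B j k = 0.
  move=> jk kj; apply/eqP; have /forallP/(_ k)/implyP := XB j; apply.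
  rewrite jk /=; apply: contra kj => /eqP; rewrite addSn addnS => -[jkn].
  by apply/eqP/val_inj; rewrite /= subSS; have := addKn j k; rewrite jkn.
set i' := rev_ord i.
have [a [b [c [d [Bi Bi']]]]] : exists a b c d,
    delta_mx 0 i *m B = a *: delta_mx 0 i + b *: delta_mx 0 i' :> 'rV_n.+1
    /\ delta_mx 0 i' *m B = c *: delta_mx 0 i' + d *: delta_mx 0 i :> 'rV_n.+1.
  have rowXB j : exists a b, delta_mx 0 j *m B =
      a *: delta_mx 0 j + b *: delta_mx 0 (rev_ord j) :> 'rV_n.+1.
    (* At the centre of an odd-sized matrix [j] is its own mirror image; the coefficient 0 keeps the
       diagonal entry from being counted twice. *)
    exists (B j j), (if rev_ord j == j then 0 else B j (rev_ord j)).
    apply/rowP => k; rewrite -rowE !mxE eqxx /=.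
    have [->|kj] := eqVneq k j.
      by case: (eqVneq j (rev_ord j)) => _; rewrite ?mulr1 ?mul0r ?mulr0 addr0.
    have [def_k|kj'] := eqVneq k (rev_ord j).
      by rewrite -def_k (negPf kj) mulr0 mulr1 add0r.
    by rewrite !mulr0 addr0 XB0 // eq_sym.
  have [a [b Bi]] := rowXB i; have [c [d Bi']] := rowXB i'.
  by rewrite rev_ordK in Bi'; exists a, b, c, d.
(* The characteristic polynomial of the block, of trace [a + c] and determinant [a * c - b * d]. At
   the centre it becomes the square of ['X - a%:P], so it has degree 2 in all cases. *)
exists ('X * 'X - ((a + c) *: 'X - (a * c - b * d)%:P)).
have sz : (size ((a + c) *: 'X - (a * c - b * d)%:P)%R < size ('X * 'X : {poly K})%R)%N.
  rewrite -expr2 size_polyXn (leq_ltn_trans (size_polyD _ _)) // gtn_max.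
  rewrite size_polyN (leq_ltn_trans (size_scale_leq _ _)) ?size_polyX //=.
  by rewrite (leq_ltn_trans (size_polyC_leq1 _)).
split.
- by rewrite monicE lead_coefDl ?size_polyN // -expr2 lead_coefXn.
- by rewrite size_polyDl ?size_polyN // -expr2 size_polyXn.
rewrite !rmorphB rmorphM /= linearZ /= horner_mx_X !horner_mx_C.
rewrite !mulmxBr -scalemxAr !mul_mx_scalar mulmxA Bi mulmxDl -!scalemxAl Bi Bi'.
by apply/rowP => k; rewrite !mxE; ring.
Qed.

Lemma Xformable_minpoly_form (K : fieldType) (n : nat) (A : 'M[K]_n.+1) :
  Xformable A -> minpoly_form (mxminpoly A).
Proof.
case=> P Pu XB; rewrite -(mxminpoly_uconj A Pu); set B := conjmx P A.
have [q qP] := fin_all_exists (fun i => Xform_annihilated i XB).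
have [F|s irr_s dvd_s] := @quadratics_lcm_bound K [seq q i | i : 'I_n.+1].
  by case/mapP => i _ ->; have [] := qP i.
apply: (dvdp_lcm_bound_form irr_s); first exact: mxminpoly_monic.
(* A polynomial in [B] vanishes as soon as it kills every basis row vector, and [lcm_bound s] is a
   multiple of each [q i]. *)
apply/mxminpoly_min/row_matrixP => i; rewrite rowE row0.
have /dvd_s/dvdpP[r ->] : q i \in [seq q i | i : 'I_n.+1] by rewrite map_f ?mem_enum.
rewrite mulrC rmorphM /= -mulmxE mulmxA.
by have [_ _ ->] := qP i; rewrite mul0mx.
Qed.

(** * Maximal families, and spans and freeness when two vectors are added *)

(** Induction on the room left, [b - size s]; excluded middle decides whether the family can still
    be extended. *)
Lemma maximal_seq (T : Type) (P : seq T -> Prop) (b : nat) :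
  P [::] -> (forall s, P s -> (size s <= b)%N) ->
  exists2 s, P s & forall x, ~ P (x :: s).
Proof.
move=> P0 Pb; suff maxP k s : P s -> (b - size s <= k)%N ->
    exists2 s', P s' & forall x, ~ P (x :: s').
  exact: (maxP b [::] P0 (leq_subr _ _)).
elim: k s => [|k IHk] s Ps s_k; have [[x Pxs]|no_x] := classic (exists x, P (x :: s)).
- by have /= := Pb _ Pxs; rewrite -subn_gt0 lt0n -leqn0 s_k.
- by exists s => // x Pxs; apply: no_x; exists x.
- by apply: (IHk _ Pxs); rewrite /= subnS -subn1 leq_subLR.
- by exists s => // x Pxs; apply: no_x; exists x.
Qed.

Lemma memv_span_cons2 (K : fieldType) (vT : vectType K) (u v w : vT) (L : seq vT) :
  w \in <<u :: v :: L>>%VS <->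
  exists a b, w - (a *: u + b *: v) \in <<L>>%VS.
Proof.
rewrite !span_cons; split.
  case/memv_addP=> _ /vlineP[a ->] [_ /memv_addP[_ /vlineP[b ->] [x xL ->]] ->].
  by exists a, b; rewrite (addrA (a *: u)) [_ + x]addrC addrK.
case=> a [b wL]; rewrite -[w](subrK (a *: u + b *: v)) addrC -addrA.
by rewrite !memv_add ?memvZ ?memv_line.
Qed.

Lemma free_cons2 (K : fieldType) (vT : vectType K) (u v : vT) (L : seq vT) :
  free [:: u, v & L] <->
  free L /\ forall a b, a *: u + b *: v \in <<L>>%VS -> a = 0 /\ b = 0.
Proof.
rewrite !free_cons span_cons; split.
  case/and3P=> uvL vL freeL; split=> // a b abL.
  have a0 : a = 0.
    apply: contraNeq uvL => a_neq0; have := rpredZeq <<v :: L>>%VS a u.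
    rewrite (negPf a_neq0) /= span_cons => <-; rewrite -[a *: u](addrK (b *: v)) addrC; apply: memv_add => //.
    by rewrite memvN memvZ ?memv_line.
  split=> //; move: abL; rewrite a0 scale0r add0r rpredZeq (negPf vL) orbF.
  by move/eqP.
case=> -> indep; rewrite andbT; apply/andP; split; apply/negP.
  case/memv_addP=> _ /vlineP[k ->] [x xL def_u].
  have [|/eqP] := indep 1 (- k); last by rewrite oner_eq0.
  by rewrite scale1r def_u scaleNr addrAC subrr add0r.
move=> vL; have [|_ /eqP] := indep 0 1; last by rewrite oner_eq0.
by rewrite scale0r add0r scale1r.
Qed.

(** * Spans of pairs [u], [u *m A] with [u] killed by a quadratic *)

Definition cyclic_pairs (K : fieldType) (n : nat) (A : 'M[K]_n)
    (s : seq 'rV[K]_n) : seq 'rV[K]_n :=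
  flatten [seq [:: u; u *m A] | u <- s].

(** The quadratic is [X^2 - b X - c]; with these signs the image of [u *m A] is given directly in
    terms of the pair. *)
Definition killed_by_quadratic (K : fieldType) (n : nat) (A : 'M[K]_n)
    (b c : K) (u : 'rV[K]_n) : Prop :=
  u *m A *m A = b *: (u *m A) + c *: u.

(* [X^2 - b X - c] has no root, or is of the form [(X - x)^2]. *)
Definition primary_quadratic (K : fieldType) (b c : K) : Prop :=
  forall x, x * x = b * x + c -> b = x + x /\ c = - (x * x).

Definition primary_vector (K : fieldType) (n : nat) (A : 'M[K]_n) (u : 'rV[K]_n) : Prop :=
  exists b c, primary_quadratic b c /\ killed_by_quadratic A b c u.

Section CyclicPairs.

Variables (K : fieldType) (n : nat) (A : 'M[K]_n).
Implicit Types (u w : 'rV[K]_n) (s t : seq 'rV[K]_n).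

Lemma cyclic_pairs_stable s w :
  (forall u, u \in s -> primary_vector A u) ->
  w \in <<cyclic_pairs A s>>%VS -> w *m A \in <<cyclic_pairs A s>>%VS.
Proof.
elim: s w => [|u s IHs] w prim_s; first by rewrite span_nil !memv0 => /eqP->; rewrite mul0mx.
have [b [c [_ uAA]]] := prim_s u (mem_head _ _).
case/memv_span_cons2=> x [y wL]; apply/memv_span_cons2.
exists (y * c), (x + y * b).
have -> : w *m A - ((y * c) *: u + (x + y * b) *: (u *m A)) =
          (w - (x *: u + y *: (u *m A))) *m A.
  rewrite mulmxBl mulmxDl -!scalemxAl uAA; move: (w *m A) (u *m A) => ? ?.
  by apply/rowP => i; rewrite !mxE; ring.
by apply: IHs => // v vs; apply: prim_s; rewrite inE vs orbT.
Qed.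

(** A dependence modulo the span [W] of the earlier pairs puts some [u *m A - z *: u] in [W]. The
    last hypothesis excludes this when [z] is a root of the quadratic; when it is not, [u] itself
    would lie in [W]. *)
Lemma free_cyclic_pairs_cons s u b c :
  (forall u, u \in s -> primary_vector A u) -> free (cyclic_pairs A s) ->
  killed_by_quadratic A b c u -> u \notin <<cyclic_pairs A s>>%VS ->
  (forall x, x * x = b * x + c -> u *m A - x *: u \notin <<cyclic_pairs A s>>%VS) ->
  free (cyclic_pairs A (u :: s)).
Proof.
move=> prim_s free_s uAA uW rootW; apply/free_cons2; split=> // x y xyW.
have y0 : y = 0.
  apply/eqP/negPn/negP => y_neq0; pose z := - (x / y).
  have zW : u *m A - z *: u \in <<cyclic_pairs A s>>%VS.
    have -> : u *m A - z *: u = y^-1 *: (x *: u + y *: (u *m A)).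
      by rewrite scalerDr !scalerA mulVf // scale1r scaleNr opprK addrC mulrC.
    by rewrite memvZ.
  have [/rootW|z_root] := eqVneq (z * z) (b * z + c); first by rewrite zW.
  suff : u \in <<cyclic_pairs A s>>%VS by rewrite (negPf uW).
  have z_neq0 : b * z + c - z * z != 0 by rewrite subr_eq0 eq_sym.
  (* Euclidean division of the quadratic by [X - z] has quotient [X - (b - z)] and a nonzero
     constant remainder. Applying [A - (b - z)] to [u *m A - z *: u] therefore leaves a nonzero
     multiple of [u]. *)
  have := memvB (cyclic_pairs_stable prim_s zW) (memvZ (b - z) zW).
  rewrite [X in X \in _](_ : _ = (b * z + c - z * z) *: u).
    by rewrite rpredZeq (negPf z_neq0).
  rewrite mulmxBl -scalemxAl uAA; move: (u *m A) => ?.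
  by apply/rowP => i; rewrite !mxE; ring.
split=> //; move: xyW; rewrite y0 scale0r addr0 rpredZeq (negPf uW) orbF.
by move/eqP.
Qed.

(* ker (A - x) is contained in im (A - x) on the span: this fails for a pair
   killed by (X - x)(X - y) with x != y, hence the primary hypothesis. *)
Lemma cyclic_pairs_exact s w x :
  (forall u, u \in s -> primary_vector A u) -> free (cyclic_pairs A s) ->
  w \in <<cyclic_pairs A s>>%VS -> w *m A = x *: w ->
  exists2 w', w' \in <<cyclic_pairs A s>>%VS & w = w' *m A - x *: w'.
Proof.
elim: s w => [|u s IHs] w prim_s.
  by rewrite span_nil memv0 => _ /eqP-> _; exists 0; rewrite ?mem0v // mul0mx scaler0 subr0.
have prim_s' v : v \in s -> primary_vector A v.
  by move=> vs; apply: prim_s; rewrite inE vs orbT.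
have [b [c [prim_bc uAA]]] := prim_s u (mem_head _ _).
case/free_cons2=> free_s indep /memv_span_cons2[y [z]]; set w0 := w - _ => w0W wA.
have def_w : w = w0 + (y *: u + z *: (u *m A)) by rewrite subrK.
have : w0 *m A - x *: w0 \in <<cyclic_pairs A s>>%VS.
  by rewrite memvB ?memvZ // cyclic_pairs_stable.
(* The component of [w *m A = x *: w] along the new pair. It lies in the span of the other pairs, so
   both coefficients vanish by freeness. *)
have w0A : w0 *m A - x *: w0 =
    (x * y - z * c) *: u + (x * z - y - z * b) *: (u *m A).
  rewrite mulmxBl mulmxDl -!scalemxAl uAA wA /w0; move: (u *m A) => ?.
  by apply/rowP => i; rewrite !mxE; ring.
rewrite w0A => /indep[eq1 eq2]; move: w0A; rewrite eq1 eq2 !scale0r addr0 => /subr0_eq w0A.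
have [w' w'W def_w0] := IHs w0 prim_s' free_s w0W w0A.
have [w'' w''W def_w''] : exists2 w'', w'' \in <<cyclic_pairs A (u :: s)>>%VS &
    y *: u + z *: (u *m A) = w'' *m A - x *: w''.
  have uW : u \in <<cyclic_pairs A (u :: s)>>%VS by rewrite memv_span ?mem_head.
  exists (z *: u); first by rewrite memvZ.
  (* If [z] is nonzero, the two equations make [x] a root of the quadratic. Primarity then gives
     [b = x + x], hence [y = - (x * z)], and the component along the pair is the image of [z *: u]
     under [A - x]. *)
  have [z0|z_neq0] := eqVneq z 0.
    have -> : y = 0.
      move: eq2; rewrite z0 mulr0 mul0r sub0r subr0 => /eqP.
      by rewrite oppr_eq0 => /eqP.
    by rewrite z0 !scale0r mul0mx scaler0 subr0 addr0.
  have xx : x * x = b * x + c.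
    apply: (mulfI z_neq0); apply/eqP; rewrite -subr_eq0; apply/eqP.
    rewrite -[RHS](addr0 0) -{1}eq1 -[0](mulr0 x) -eq2; ring.
  have [def_b _] := prim_bc x xx.
  have def_y : y = - (x * z).
    apply/eqP; rewrite -subr_eq0 opprK; apply/eqP.
    by rewrite -[RHS]oppr0 -eq2 def_b; ring.
  by rewrite def_y -scalemxAl scalerA scaleNr addrC.
exists (w' + w''); last first.
  by rewrite def_w def_w0 def_w'' mulmxDl scalerDr opprD addrACA.
apply: memvD => //; apply/memv_span_cons2; exists 0, 0.
by rewrite !scale0r addr0 subr0.
Qed.

End CyclicPairs.

(** * Kernels of polynomials in [A] contained in a given subspace *)

Lemma coprimep_prodr (K : fieldType) (I : eqType) (r : seq I) (p : {poly K})
    (F : I -> {poly K}) :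
  (forall i, i \in r -> coprimep p (F i)) -> coprimep p (\prod_(i <- r) F i).
Proof.
move=> pF; rewrite big_seq; elim/big_rec: _ => [|i q ir pq]; first exact: coprimep1.
by rewrite coprimepMr pF.
Qed.

Lemma monic_size3 (K : fieldType) (p : {poly K}) :
  p \is monic -> size p = 3%N -> p = 'X * 'X + p`_1 *: 'X + (p`_0)%:P.
Proof.
move=> /monicP; rewrite lead_coefE => + sz_p; rewrite sz_p /= => p2.
apply/polyP => i; rewrite -expr2 !coefD coefXn coefZ coefX coefC.
case: i => [|[|[|i]]] /=; rewrite ?mulr0 ?mulr1 ?add0r ?addr0 ?p2 //.
by rewrite nth_default ?sz_p.
Qed.

Lemma irreducible_noroot (K : fieldType) (p : {poly K}) (x : K) :
  irreducible_poly p -> size p = 3%N -> ~~ root p x.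
Proof.
move=> irr_p sz_p; apply/negP; rewrite -dvdp_XsubCl => dvd_p.
have sz_X : size ('X - x%:P) != 1%N by rewrite size_XsubC.
by have /eqp_size := apply_irredp irr_p sz_X dvd_p; rewrite size_XsubC sz_p.
Qed.

Definition annihilated_in (K : fieldType) (n : nat) (A : 'M[K]_n.+1)
    (W : {vspace 'rV[K]_n.+1}) (p : {poly K}) : Prop :=
  forall u, u *m horner_mx A p = 0 -> u \in W.

Section AnnihilatedIn.

Variables (K : fieldType) (n : nat) (A : 'M[K]_n.+1) (W : {vspace 'rV[K]_n.+1}).

(** The Bezout identity [a * p + b * q = 1] splits [u] into a part killed by [q] and a part killed
    by [p]. *)
Lemma annihilated_in_mul p q :
  coprimep p q -> annihilated_in A W p -> annihilated_in A W q ->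
  annihilated_in A W (p * q).
Proof.
case/Bezout_eq1_coprimepP=> -[a b] /= bezout Wp Wq u u_pq.
have -> : u = u *m horner_mx A (a * p) + u *m horner_mx A (b * q).
  by rewrite -mulmxDr -rmorphD /= bezout rmorph1 mulmx1.
apply: memvD; [apply: Wq | apply: Wp]; rewrite -mulmxA mulmxE -rmorphM /=.
  by rewrite -mulrA mulrC rmorphM /= -mulmxE mulmxA u_pq mul0mx.
by rewrite -mulrA mulrC [q * p]mulrC rmorphM /= -mulmxE mulmxA u_pq mul0mx.
Qed.

Lemma annihilated_in_prod (I : eqType) (r : seq I) (F : I -> {poly K}) :
  uniq r -> (forall i j, i != j -> coprimep (F i) (F j)) ->
  (forall i, annihilated_in A W (F i)) ->
  annihilated_in A W (\prod_(i <- r) F i).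
Proof.
move=> + co_F WF; elim: r => [_ u|i r IHr /andP[ir ur]].
  by rewrite big_nil rmorph1 mulmx1 => ->; rewrite mem0v.
rewrite big_cons; apply: annihilated_in_mul => //; last exact: IHr.
by apply: coprimep_prodr => j jr; apply: co_F; apply: contraNneq ir => ->.
Qed.

Hypothesis W_quad : forall b c u,
  primary_quadratic b c -> killed_by_quadratic A b c u -> u \in W.

(** Without a root, the quadratic is primary vacuously. *)
Lemma annihilated_in_irr p :
  irreducible_poly p -> p \is monic -> size p = 3%N -> annihilated_in A W p.
Proof.
move=> irr_p p_mon sz_p u up.
apply: (W_quad (b := - p`_1) (c := - p`_0)).
  move=> x xx; have /negP[] := irreducible_noroot x irr_p sz_p.
  by rewrite rootE (monic_size3 p_mon sz_p) !hornerE xx; apply/eqP; ring.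
move: up; rewrite {1}(monic_size3 p_mon sz_p) !rmorphD rmorphM /= linearZ /=.
rewrite horner_mx_X horner_mx_C !mulmxDr -scalemxAr mul_mx_scalar mulmxA.
rewrite /killed_by_quadratic !scaleNr -opprD -addrA => /eqP.
by rewrite addr_eq0 => /eqP.
Qed.

Lemma annihilated_in_XsubC_exp x e :
  (1 <= e <= 2)%N -> annihilated_in A W (('X - x%:P) ^+ e).
Proof.
move=> e12 u u_e.
(* Exponent 1 reduces to exponent 2, so that a single primary quadratic, [(X - x)^2], covers both
   cases. *)
have {e e12 u_e} : u *m horner_mx A (('X - x%:P) * ('X - x%:P)) = 0.
  case: e e12 u_e => [|[|[|e]]] // _; rewrite ?expr2 // expr1 => u1.
  by rewrite rmorphM /= -mulmxE mulmxA u1 mul0mx.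
rewrite rmorphM rmorphB /= horner_mx_X horner_mx_C -mulmxE mulmxA.
rewrite !mulmxBr !mulmxBl !mul_mx_scalar -!scalemxAl => uxx.
apply: (W_quad (b := x + x) (c := - (x * x))).
  move=> y yy; have /eqP : (y - x) ^+ 2 = 0 by rewrite expr2 mulrBl !mulrBr yy; ring.
  by rewrite expf_eq0 subr_eq0 /= => /eqP ->.
rewrite /killed_by_quadratic; move: (u *m A) (u *m A *m A) uxx => ? ? uxx.
apply/rowP => i; move/rowP/(_ i): uxx; rewrite !mxE => uxx.
by apply/eqP; rewrite -subr_eq0 -uxx; apply/eqP; ring.
Qed.

End AnnihilatedIn.

(** * Construction of the basis and its arrangement in X-form *)

(** The order of choice matters: [s] is made maximal first, then eigenvectors [t] are added to the
    fixed pairs of [s]. *)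
Lemma adapted_family (K : fieldType) (n : nat) (A : 'M[K]_n) :
  exists s t : seq 'rV[K]_n,
    [/\ free (t ++ cyclic_pairs A s),
        forall u, u \in s -> primary_vector A u,
        forall v, v \in t -> exists x, v *m A = x *: v
      & forall b c u, primary_quadratic b c -> killed_by_quadratic A b c u ->
          u \in <<t ++ cyclic_pairs A s>>%VS].
Proof.
have free_size (L : seq 'rV[K]_n) : free L -> (size L <= n)%N.
  move=> /eqP <-; rewrite (leq_trans (dimvS (subvf _))) //.
  by rewrite dimvf /dim /= mul1n.
pose P1 s := (forall u, u \in s -> primary_vector A u) /\ free (cyclic_pairs A s).
have [||s [prim_s free_s] max_s] := @maximal_seq _ P1 n.
- by split; rewrite ?nil_free.
- move=> s [_ /free_size]; apply: leq_trans.
  by elim: s => //= u s IHs; rewrite ltnS (leq_trans IHs).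
pose P2 t := (forall v, v \in t -> exists x, v *m A = x *: v) /\ free (t ++ cyclic_pairs A s).
have [||t [eig_t free_ts] max_t] := @maximal_seq _ P2 n.
- by [].
- by move=> t [_ /free_size]; rewrite size_cat; apply: leq_trans; rewrite leq_addr.
exists s, t; split=> // b c u prim_bc uAA.
have sub_st : (<<cyclic_pairs A s>> <= <<t ++ cyclic_pairs A s>>)%VS.
  by rewrite span_cat addvSr.
have eigW x v : v *m A = x *: v -> v \in <<t ++ cyclic_pairs A s>>%VS.
  move=> vA; apply/negPn/negP => vW; apply: (max_t v); split=> [w|].
    by rewrite inE => /predU1P[->|/eig_t //]; exists x.
  by rewrite /= free_cons vW.
apply/negPn/negP => uW.
have uW1 : u \notin <<cyclic_pairs A s>>%VS by apply: contra uW; apply: subvP.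
apply: (max_s u); split=> [w|].
  by rewrite inE => /predU1P[->|/prim_s //]; exists b, c.
(* The pair of [u] could extend [s] unless [u *m A - x *: u] lies in the span of the pairs for some
   root [x]. That vector is then killed by [A - x], so it is [w' *m A - x *: w'] for some [w'] in
   this span. Hence [u - w'] is killed by [A - x] and lies in the full span by maximality of [t],
   and so does [u]. *)
apply: (free_cyclic_pairs_cons (b := b) (c := c)) => // x xx; apply/negP => wW.
have [def_b def_c] := prim_bc x xx.
have [|w' w'W def_w'] := cyclic_pairs_exact (x := x) prim_s free_s wW.
  rewrite mulmxBl -scalemxAl uAA def_b def_c; move: (u *m A) => ?.
  by apply/rowP => i; rewrite !mxE; ring.
case/negP: uW; rewrite -[u](subrK w').
apply: memvD; last exact: (subvP sub_st).
apply: (eigW x); rewrite mulmxBl scalerBr; apply/eqP; rewrite subr_eq.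
by rewrite addrAC -addrA addrC -subr_eq def_w'.
Qed.

(** The X-form condition read row by row on a list of vectors; with indices from 0, the mirror image
    of [i] is [size L - i.+1]. *)
Definition Xlist (K : fieldType) (n : nat) (A : 'M[K]_n) (L : seq 'rV[K]_n) : Prop :=
  forall i, (i < size L)%N ->
    exists a b, L`_i *m A = a *: L`_i + b *: L`_(size L - i.+1).

Lemma Xlist_wrap (K : fieldType) (n : nat) (A : 'M[K]_n) (L : seq 'rV[K]_n) u v :
  Xlist A L -> (exists a b, u *m A = a *: u + b *: v) ->
  (exists a b, v *m A = a *: v + b *: u) -> Xlist A (u :: rcons L v).
Proof.
move=> XL uA vA [|i]; rewrite /= size_rcons.
  by rewrite subn1 /= nth_rcons ltnn eqxx.
rewrite !ltnS leq_eqVlt subSS => /predU1P[->|iL].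
  by rewrite subnn nth_rcons ltnn eqxx.
rewrite subSn //= !nth_rcons iL; have [a [b LA]] := XL i iL.
by exists a, b; rewrite ltn_subrL (leq_ltn_trans _ iL).
Qed.

Lemma Xlist_exists (K : fieldType) (n : nat) (A : 'M[K]_n) (s t : seq 'rV[K]_n) :
  (forall u, u \in s -> primary_vector A u) ->
  (forall v, v \in t -> exists x, v *m A = x *: v) ->
  exists2 L, perm_eq L (t ++ cyclic_pairs A s) & Xlist A L.
Proof.
move=> prim_s eig_t; elim: s prim_s => [_|u s IHs prim_s].
  (* Induction on a bound for the size, since eigenvectors are removed two at a time; a last one
     left alone sits at the centre. *)
  rewrite cats0; have [m] := ubnP (size t); elim: m t eig_t => // m IHm.
  case=> [|v [|w t]] eig_t sz_t; first by exists [::].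
    exists [:: v] => // -[|i] //= _; have [x ->] := eig_t v (mem_head _ _).
    by exists x, 0; rewrite scale0r addr0.
  have [|| L permL XL] := IHm t.
  - by move=> z zt; apply: eig_t; rewrite !inE zt !orbT.
  - by rewrite (ltn_trans (ltnSn _)).
  exists (v :: rcons L w); first by rewrite perm_cons perm_rcons perm_cons.
  apply: Xlist_wrap => //.
    by have [|x ->] := eig_t v; rewrite ?mem_head //; exists x, 0; rewrite scale0r addr0.
  have [|x ->] := eig_t w; first by rewrite !inE eqxx orbT.
  by exists x, 0; rewrite scale0r addr0.
have [|L permL XL] := IHs; first by move=> v vs; apply: prim_s; rewrite inE vs orbT.
have [b [c [_ uAA]]] := prim_s u (mem_head _ _).
exists (u :: rcons L (u *m A)).
  have -> : cyclic_pairs A (u :: s) = [:: u; u *m A] ++ cyclic_pairs A s by [].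
  by rewrite perm_sym perm_catCA perm_sym /= perm_cons perm_rcons perm_cons.
apply: Xlist_wrap => //; last by exists b, c.
by exists 0, 1; rewrite scale0r add0r scale1r.
Qed.

Lemma Xformable_of_Xlist (K : fieldType) (n : nat) (A : 'M[K]_n) (L : seq 'rV[K]_n) :
  free L -> size L = n -> Xlist A L -> Xformable A.
Proof.
move=> freeL sz_L XL; pose P : 'M[K]_n := \matrix_i L`_i.
have Pu : P \in unitmx.
  rewrite -row_free_unit; apply: inj_row_free => v vP0.
  have tL : size L == n by rewrite sz_L.
  have /freeP indep := freeL : free (Tuple tL).
  apply/rowP => i; rewrite mxE; apply: (indep (fun i => v 0 i)).
  by rewrite -[RHS]vP0 mulmx_sum_row; apply: eq_bigr => j _; rewrite rowK.
suff : is_Xform_mx (conjmx P A) by exists P.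
rewrite conjumx //.
apply/forallP => i; apply/forallP => j; apply/implyP => /andP[ij ij'].
have [|a [b LA]] := XL i; first by rewrite sz_L.
(* Right multiplication by [invmx P] reads off coordinates in the basis [L]. *)
have rowPV (k : 'I_n) : L`_k *m invmx P = delta_mx 0 k.
  have -> : L`_k = row k P by rewrite rowK.
  by rewrite -row_mul mulmxV // rowE mulmx1.
have -> : (P *m A *m invmx P) i j = row i (P *m A *m invmx P) 0 j by rewrite [RHS]mxE.
rewrite !row_mul rowK LA sz_L mulmxDl -!scalemxAl (rowPV i) (rowPV (rev_ord i)).
have /negPf ji' : j != rev_ord i.
  by apply: contra ij' => /eqP ->; rewrite /= addnS subnKC.
by rewrite !mxE eqxx /= [j == i]eq_sym (negPf ij) ji' !mulr0 addr0.
Qed.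

Lemma minpoly_form_Xformable (K : fieldType) (n : nat) (A : 'M[K]_n.+1) :
  minpoly_form (mxminpoly A) -> Xformable A.
Proof.
case=> r [q] [P] [lambda] [e] [P_irr P_inj lambda_inj e12 def_mp].
have [s [t [free_ts prim_s eig_t W_quad]]] := adapted_family A.
set W := <<_>>%VS in W_quad.
have irr_neq (p p' : {poly K}) : irreducible_poly p -> p \is monic ->
    size p = 3%N -> p' \is monic -> size p' = 3%N -> p != p' -> coprimep p p'.
  move=> irr_p p_mon sz_p p'_mon sz_p'; rewrite irreducible_poly_coprime //.
  by apply: contra => pp'; rewrite -eqp_monic // -dvdp_size_eqp // sz_p sz_p'.
have Wmp : annihilated_in A W (mxminpoly A).
  rewrite def_mp; apply: annihilated_in_mul.
  - apply: coprimep_prodr => i _; apply: coprimep_expr.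
    rewrite coprimep_sym; apply: coprimep_prodr => j _.
    have [irrP _ szP] := P_irr j.
    by rewrite coprimep_sym coprimep_XsubC irreducible_noroot.
  - apply: annihilated_in_prod => [|i j ij|i]; first exact: index_enum_uniq.
      have [irrP monP szP] := P_irr i; have [_ monP' szP'] := P_irr j.
      by apply: irr_neq => //; rewrite (inj_eq P_inj).
    by have [irrP monP szP] := P_irr i; apply: annihilated_in_irr.
  apply: annihilated_in_prod => [|i j ij|i]; first exact: index_enum_uniq.
    apply/coprimep_expl/coprimep_expr.
    by rewrite coprimep_XsubC root_XsubC (inj_eq lambda_inj) eq_sym.
  exact: annihilated_in_XsubC_exp.
have [L permL XL] := Xlist_exists prim_s eig_t.
have freeL : free L by rewrite (perm_free permL).
apply: (Xformable_of_Xlist freeL) => //.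
(* The minimal polynomial kills every vector, so the free family spans the whole space and its
   length is the dimension. *)
have WT : W = fullv.
  apply/eqP; rewrite eqEsubv subvf; apply/subvP => u _; apply: Wmp.
  by rewrite mx_root_minpoly mulmx0.
move: free_ts; rewrite (perm_size permL) /free -/W WT dimvf /dim /= mul1n.
by move/eqP.
Qed.

Theorem theorem1p2 (K : fieldType) (n : nat) (A : 'M[K]_n.+1) :
  Xformable A <->
  exists (r q : nat) (P : 'I_r -> {poly K}) (lambda : 'I_q -> K)
         (e : 'I_q -> nat),
    [/\ forall i : 'I_r,
          [/\ irreducible_poly (P i), P i \is monic & size (P i) = 3%N],
        injective P,
        injective lambda,
        forall i : 'I_q, (1 <= e i <= 2)%N
      & mxminpoly A =
          (\prod_(i < r) P i) * (\prod_(i < q) ('X - (lambda i)%:P) ^+ e i)].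
Proof.
split; [exact: Xformable_minpoly_form | exact: minpoly_form_Xformable].
Qed.
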